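(* Let $N\le 2$ (i.e. $N\in\{1,2\}$), and let $(u,v)$ be a solution of $$\begin{cases}-\Delta u=u-u^3-uv^2 & \text{in }\mathbb{R}^N\\ -\Delta v=v-v^3-u^2v & \text{in }\mathbb{R}^N\\ u,v>0 & \text{in }\mathbb{R}^N.\end{cases}$$ Then $(u,v)$ is constant, necessarily satisfying $u^2+v^2=1$.
   Context: A solution is a pair $(u,v)\in L^3_{loc}(\mathbb{R}^N)\times L^3_{loc}(\mathbb{R}^N)$ of real-valued functions solving the system in the sense of distributions. Such solutions are smooth (up to modification on a null set), and pointwise conditions refer to the smooth representatives. *)

(* Defs.v *)
From HB Require Import structures.
From mathcomp Require Import all_boot all_order all_algebra.
From mathcomp Require Import all_classical all_reals all_analysis.
Set Implicit Arguments.
Unset Strict Implicit.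
Unset Printing Implicit Defensive.
Import Order.TTheory GRing.Theory Num.Theory.
Import numFieldNormedType.Exports.
Local Open Scope classical_set_scope.
Local Open Scope ring_scope.

(* Borel sigma-algebra of R^n, generated by the coordinate functions. *)

Definition rV_display : measure_display.
Proof. exact: default_measure_display. Qed.

Section measurable_rV.
Variables (R : realType) (n : nat).

Let coord_ (i : 'I_n) (x : 'rV[R]_n) : measurableTypeR R := x ord0 i.

Let rV_set0 : g_sigma_preimage coord_ set0.
Proof. exact: sigma_algebra0. Qed.

Let rV_setC A : g_sigma_preimage coord_ A -> g_sigma_preimage coord_ (~` A).
Proof. exact: sigma_algebraC. Qed.

Let rV_bigcup (F : _^nat) : (forall i, g_sigma_preimage coord_ (F i)) ->
  g_sigma_preimage coord_ (\bigcup_i (F i)).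
Proof. exact: sigma_algebra_bigcup. Qed.

HB.instance Definition _ := @isMeasurable.Build rV_display
  'rV[R]_n (g_sigma_preimage coord_) rV_set0 rV_setC rV_bigcup.

Lemma measurable_rV_coord (i : 'I_n) :
  measurable_fun [set: 'rV[R]_n] (fun x => x ord0 i : measurableTypeR R).
Proof.
move=> _ Y mY; rewrite setTI; apply: sub_sigma_algebra => /=.
rewrite -bigcup_seq/=; exists i => /=; first by rewrite mem_index_enum.
by exists Y => //; rewrite setTI.
Qed.

Lemma measurable_fun_rV d (T : measurableType d) (f : T -> 'rV[R]_n) :
  (forall i, measurable_fun setT (fun t => f t ord0 i : measurableTypeR R)) ->
  measurable_fun setT f.
Proof.
move=> mf _ A mA; rewrite setTI.
suff : (g_sigma_preimage coord_ `<=` [set B | measurable (f @^-1` B)]) by exact.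
apply: smallest_sub.
  split=> /=; first by rewrite preimage_set0.
    by move=> B mB; rewrite setTD preimage_setC; exact: measurableC.
  by move=> F mF; rewrite preimage_bigcup; exact: bigcup_measurable.
move=> B; rewrite -bigcup_seq/= => -[i _ [Y mY <-]].
rewrite setTI /= -comp_preimage -[X in measurable X]setTI.
exact: mf.
Qed.

End measurable_rV.

(* Lebesgue measure on R^n, by iterating the binary product measure along
   R * R^n -> R^n.+1; on R^0 it is the unit mass. *)

Section lebesgue_rV_step.
Variables (R : realType) (n : nat).
Variable mu : {sigma_finite_measure set 'rV[R]_n -> \bar R}.

Definition cons_rV (p : measurableTypeR R * 'rV[R]_n) : 'rV[R]_n.+1 :=
  row_mx (const_mx p.1 : 'rV[R]_1) p.2.

Definition uncons_rV (x : 'rV[R]_n.+1) : measurableTypeR R * 'rV[R]_n :=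
  (x ord0 ord0, \row_(j < n) x ord0 (lift ord0 j)).

Lemma cons_rVK : cancel cons_rV uncons_rV.
Proof.
move=> [a y]; rewrite /uncons_rV /cons_rV /=; congr pair.
  have -> : ord0 = lshift n (ord0 : 'I_1) by exact/val_inj.
  by rewrite (row_mxEl (const_mx a : 'rV_1)) mxE.
apply/rowP => j; rewrite mxE.
have -> : lift ord0 j = rshift 1 j by exact/val_inj.
by rewrite (row_mxEr (const_mx a : 'rV_1)).
Qed.

Lemma measurable_cons_rV : measurable_fun setT cons_rV.
Proof.
apply: measurable_fun_rV => i; rewrite /cons_rV.
case: (split_ordP (i : 'I_(1 + n))) => j ->.
- have -> : (fun p : measurableTypeR R * 'rV[R]_n =>
      (row_mx (const_mx p.1 : 'rV[R]_1) p.2) ord0 (lshift n j)) = fst.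
    by apply/funext => p; rewrite row_mxEl mxE.
  exact: measurable_fst.
- have -> : (fun p : measurableTypeR R * 'rV[R]_n =>
      (row_mx (const_mx p.1 : 'rV[R]_1) p.2) ord0 (rshift 1 j)) =
      (fun x : 'rV[R]_n => x ord0 j) \o snd.
    by apply/funext => p; rewrite row_mxEr.
  exact: (measurableT_comp (measurable_rV_coord j) measurable_snd).
Qed.

Lemma measurable_uncons_rV : measurable_fun setT uncons_rV.
Proof.
apply/measurable_fun_pairP; split; first exact: measurable_rV_coord.
apply: measurable_fun_rV => i.
rewrite [X in measurable_fun _ X](_ : _ =
  (fun x : 'rV[R]_n.+1 => x ord0 (lift ord0 i))).
  exact: measurable_rV_coord.
by apply/funext => x; rewrite /= mxE.
Qed.

HB.instance Definition _ :=
  isMeasurableFun.Build _ _ _ _ cons_rV measurable_cons_rV.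

Definition lebesgue_rV_step : set 'rV[R]_n.+1 -> \bar R :=
  pushforward (@lebesgue_measure R \x mu)%E cons_rV.

Let step0 : lebesgue_rV_step set0 = 0%E.
Proof. by rewrite /lebesgue_rV_step /pushforward preimage_set0 measure0. Qed.

Let step_ge0 A : (0 <= lebesgue_rV_step A)%E.
Proof. exact: measure_ge0. Qed.

Let step_sigma_additive : semi_sigma_additive lebesgue_rV_step.
Proof.
exact: (@measure_semi_sigma_additive _ _ _
  (pushforward (@lebesgue_measure R \x mu)%E cons_rV)).
Qed.

HB.instance Definition _ := isMeasure.Build _ _ _ lebesgue_rV_step
  step0 step_ge0 step_sigma_additive.

Let step_sigma_finite : sigma_finite setT lebesgue_rV_step.
Proof.
have [F FT mF] : sigma_finite setT (@lebesgue_measure R \x mu)%E.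
  have /sigma_finiteP[F [TF ndF Foo]] := sigma_finiteT (@lebesgue_measure R).
  have /sigma_finiteP[G [TG ndG Goo]] := sigma_finiteT mu.
  exists (fun k => F k `*` G k).
    rewrite -setXTT TF TG predeqE => -[x y]; split.
      move=> [/= [k _ Fkx] [l _ Gly]]; exists (maxn k l) => //; split.
      - by move: x Fkx; exact/subsetPset/ndF/leq_maxl.
      - by move: y Gly; exact/subsetPset/ndG/leq_maxr.
    by move=> [k _ []/= ? ?]; split; exists k.
  move=> k; have [? ?] := Foo k; have [? ?] := Goo k.
  split; first exact: measurableX.
  by rewrite product_measure1E// lte_mul_pinfty// ge0_fin_numE.
exists (fun k => uncons_rV @^-1` F k).
  by rewrite -preimage_bigcup -FT preimage_setT.
move=> k; have [mFk Fkoo] := mF k; split.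
  by rewrite -[X in measurable X]setTI; exact: measurable_uncons_rV.
rewrite /lebesgue_rV_step /pushforward -comp_preimage.
by rewrite (_ : uncons_rV \o cons_rV = id)//; apply/funext => p; exact: cons_rVK.
Qed.

HB.instance Definition _ := Measure_isSigmaFinite.Build _ _ _ lebesgue_rV_step
  step_sigma_finite.

End lebesgue_rV_step.

Fixpoint lebesgue_rV (R : realType) (n : nat) :
    {sigma_finite_measure set 'rV[R]_n -> \bar R} :=
  match n with
  | 0 => \d_(0 : 'rV[R]_0)
  | m.+1 => lebesgue_rV_step (lebesgue_rV R m)
  end.

Section distributional_solutions.
Variables (R : realType) (n : nat).
Implicit Types (f u v U phi : 'rV[R]_n -> R).

(* C^k by recursion on the coordinate partial derivatives. *)
Fixpoint is_Ck (k : nat) f : Prop :=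
  match k with
  | 0 => continuous f
  | k'.+1 => continuous f /\
      forall i : 'I_n, (forall x, derivable f x (delta_mx ord0 i)) /\
                       is_Ck k' ('D_(delta_mx ord0 i) f)
  end.

Definition smooth f : Prop := forall k, is_Ck k f.

Definition laplacian f : 'rV[R]_n -> R := fun x =>
  \sum_(i < n) 'D_(delta_mx ord0 i) ('D_(delta_mx ord0 i) f) x.

Definition test_function phi : Prop :=
  smooth phi /\ compact (closure [set x | phi x != 0]).

Definition locally_Lp (p : \bar R) f : Prop :=
  forall K : set 'rV[R]_n, compact K -> f \_ K \in Lfun (lebesgue_rV R n) p.

(* - Delta u = g in the sense of distributions.  Rintegral is 0 on
   non-integrable functions; for u and g locally integrable both integrands
   below are integrable. *)
Definition neg_laplacian_distr u (g : 'rV[R]_n -> R) : Prop :=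
  forall phi, test_function phi ->
    \int[lebesgue_rV R n]_x (u x * - laplacian phi x) =
    \int[lebesgue_rV R n]_x (g x * phi x).

Definition is_solution u v : Prop :=
  [/\ locally_Lp 3%:E u, locally_Lp 3%:E v,
      neg_laplacian_distr u (fun x => u x - u x ^+ 3 - u x * v x ^+ 2) &
      neg_laplacian_distr v (fun x => v x - v x ^+ 3 - u x ^+ 2 * v x)].

Definition smooth_representative u U : Prop :=
  smooth U /\ {ae lebesgue_rV R n, forall x, u x = U x}.

(* Elements of L^3_loc have no pointwise values: positivity on R^n is that of
   the smooth representative, which is unique as it is continuous. *)
Definition everywhere_positive u : Prop :=
  exists2 U, smooth_representative u U & forall x, 0 < U x.

End distributional_solutions.

(* Main.v *)
Require Import Defs.
From mathcomp Require Import all_boot all_order all_algebra.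
From mathcomp Require Import all_classical all_reals all_analysis.
From mathcomp Require Import measurable_realfun ring lra.
Import Order.TTheory GRing.Theory Num.Theory.
Import numFieldNormedType.Exports.
Local Open Scope classical_set_scope.
Local Open Scope ring_scope.
Set Implicit Arguments.
Unset Strict Implicit.
Unset Printing Implicit Defensive.

(* Testing against bumps turns the distributional system for the smooth
   representatives U, V into Delta U = - c U, Delta V = - c V pointwise, with
   c = 1 - U^2 - V^2.  Then Delta c <= 2 c (1 - c), and a Keller-Osserman
   argument bounds - c(a) R^2 independently of R, so c >= 0.  Hence U and V are
   positive and superharmonic, thus constant in dimension at most 2, and c U = 0
   forces c = 0. *)

(** * Directional derivatives and functions of class C^k *)

Section directional_derivatives.
Context {R : realType} {V : normedModType R}.
Implicit Types (f : V -> R) (x v : V).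

(** Nothing is known about U and V at infinity, so neither c nor a positive superharmonic function
    need attain its infimum. Both global steps therefore use a barrier that forces a minimum into
    the interior of a compact set, where the gradient vanishes and the Laplacian is nonnegative. For
    c the barrier is a factor: with w = - c, solutions of Delta w = 2 w^2 that blow up on a sphere
    do so like the inverse square of the distance to it, and q^2 vanishes there to exactly that
    order. Every term of the resulting inequality then carries a factor c that can be divided out.
    For U and V the barrier is a summand. In dimension 2, log |x - a|^2 is harmonic, which is only
    borderline; the second logarithm makes it strictly superharmonic and keeps it unbounded, so an
    interior minimum is contradictory at once. *)

Lemma is_derive_line f x v (t d : R) :
  is_derive (t *: v + x) v f d -> is_derive t 1 (fun h => f (h *: v + x)) d.
Proof.
case=> df <-.
have E : (fun h : R => h^-1 *: (((fun h0 : R => f (h0 *: v + x)) \o shift t) (h *: (1:R))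
            - f (t *: v + x))) =
    (fun h => h^-1 *: ((f \o shift (t *: v + x)) (h *: v) - f (t *: v + x))).
  by apply/funext => h /=; rewrite [h *: (1:R)]mulr1 scalerDl addrA.
by apply: DeriveDef; rewrite /derivable /derive E.
Qed.

(** The two difference quotients at 0 are the same function of h, so one-variable results (chain
    rule, minima, integration along a coordinate) transfer to directional derivatives. *)
Lemma is_derive_lineP f x v (d : R) :
  is_derive x v f d <-> is_derive (0 : R) 1 (fun h => f (h *: v + x)) d.
Proof.
have E : (fun h : R => h^-1 *: (((fun h0 : R => f (h0 *: v + x)) \o shift 0) (h *: (1:R))
            - f (0 *: v + x))) =
    (fun h => h^-1 *: ((f \o shift x) (h *: v) - f x)).
  by apply/funext => h /=; rewrite [h *: (1:R)]mulr1 addr0 scale0r add0r.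
by split=> -[]; rewrite /derivable /derive ?E => df <-; apply: DeriveDef;
  rewrite /derivable /derive ?E.
Qed.

Lemma is_derive_comp_real f x v (g : R -> R) (a b : R) :
  is_derive (f x) 1 g a -> is_derive x v f b -> is_derive x v (g \o f) (a * b).
Proof.
move=> dg /is_derive_lineP df; apply/is_derive_lineP.
apply: (is_derive1_comp (f := g) (g := fun h => f (h *: v + x))).
by rewrite scale0r add0r.
Qed.

(** If d < 0, then g1 is negative on some interval to the right of 0, and the mean value theorem
    yields g s < g 0. Only differentiability of g1 at the single point 0 is used. *)
Lemma derive2_min_real (g g1 : R -> R) (e d : R) : 0 < e ->
  (forall t : R, `|t| < e -> is_derive t 1 g (g1 t)) -> is_derive (0 : R) 1 g1 d ->
  (forall t : R, `|t| < e -> g 0 <= g t) -> g1 0 = 0 /\ 0 <= d.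
Proof.
move=> e0 dg dg1 gmin.
have itvE t : (t \in `]- e, e[) = (`|t| < e) by rewrite in_itv/= ltr_norml.
have g10 : g1 0 = 0.
  have N0 : `|0 : R| < e by rewrite normr0.
  have H : is_derive (0:R) 1 g 0.
    apply: (@derive1_at_min _ g (- e) e 0).
    - by rewrite ltW// (lt_trans _ e0)// oppr_lt0.
    - by move=> t; rewrite itvE => /dg; case.
    - by rewrite itvE.
    - by move=> t; rewrite itvE; exact: gmin.
  by have [_ <-] := dg 0 N0; have [_ ->] := H.
split=> //; rewrite leNgt; apply/negP => d0.
have [dg1' dE] := dg1.
have Hd : (fun h : R => h^-1 *: ((g1 \o shift 0) (h *: (1:R)) - g1 0)) @ 0^' --> d.
  by rewrite -dE.
have [|r /= r0 Hr] := Hd [set z | z < 0]; first exact: lt_nbhsl.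
pose s := Num.min r e / 2.
have m0 : 0 < Num.min r e by rewrite lt_min r0.
have s0 : 0 < s by rewrite divr_gt0.
have [sr se] : s < r /\ s < e.
  have : s < Num.min r e by rewrite ltr_pdivrMr// mulr_natr mulr2n ltrDl.
  by rewrite lt_min => /andP.
have neg t : 0 < t -> t <= s -> g1 t < 0.
  move=> t0 ts; have := Hr t; rewrite /= sub0r normrN gtr0_norm// => /(_ (le_lt_trans ts sr)).
  rewrite addr0 [t *: _]mulr1 g10 subr0 => /(_ (lt0r_neq0 t0)).
  by rewrite /GRing.scale/= pmulr_rlt0// invr_gt0.
have [||c] := @MVT R g g1 0 s s0.
- move=> t; rewrite in_itv/= => /andP[t0 ts]; apply: dg.
  by rewrite gtr0_norm// (lt_trans ts).
- apply: continuous_in_subspaceT => t; rewrite inE/= in_itv/= => /andP[t0 ts].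
  apply: differentiable_continuous; apply/derivable1_diffP.
  by have [|] := dg t; rewrite // ger0_norm// (le_lt_trans ts).
rewrite in_itv/= => /andP[c0 cs]; rewrite subr0 => E.
have := gmin s; rewrite gtr0_norm// => /(_ se); rewrite -subr_ge0 E leNgt.
by rewrite pmulr_llt0// (neg _ c0 (ltW cs)).
Qed.

Lemma derive2_min f x v : (\forall z \near x, derivable f z v) ->
  derivable ('D_v f) x v -> (\forall z \near x, f x <= f z) ->
  'D_v f x = 0 /\ 0 <= 'D_v ('D_v f) x.
Proof.
move=> df ddf fmin.
have lc : (fun h : R => h *: v + x) @ (0:R) --> x.
  rewrite -[X in _ --> X]add0r -[X in _ --> X + _](scale0r v).
  by apply: cvgD; [exact: scalel_continuous|exact: cvg_cst].
have [e /= e0 He] : \forall h \near (0:R), derivable f (h *: v + x) v /\ f x <= f (h *: v + x).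
  exact: (lc _ (filterI df fmin)).
have [||t te|a b] := @derive2_min_real (fun h => f (h *: v + x)) (fun h => 'D_v f (h *: v + x)) e
   ('D_v ('D_v f) x) e0.
- move=> t te; apply: is_derive_line; apply/derivableP.
  by have [] := He t; rewrite //= sub0r normrN.
- exact: (proj1 (is_derive_lineP ('D_v f) x v _) (derivableP ddf)).
- by rewrite scale0r add0r; have [] := He t; rewrite //= sub0r normrN.
by split=> //; rewrite -a scale0r add0r.
Qed.

End directional_derivatives.

Section Ck_functions.
Context {R : realType} {n : nat}.
Implicit Types (f g : 'rV[R]_n -> R) (x : 'rV[R]_n) (i : 'I_n).
Local Notation e_ i := (delta_mx ord0 i : 'rV[R]_n).

Lemma is_Ck_continuous k f : is_Ck k f -> continuous f.
Proof. by case: k => [|k]//= []. Qed.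

Lemma is_CkW k f : is_Ck k.+1 f -> is_Ck k f.
Proof.
elim: k f => [|k IH] f; first by case.
by case=> cf Hf; split=> // i; have [df /IH] := Hf i.
Qed.

Lemma is_Ck_derivable k f x i : is_Ck k.+1 f -> derivable f x (e_ i).
Proof. by case=> _ /(_ i)[]. Qed.

Lemma is_Ck_derive k f i : is_Ck k.+1 f -> is_Ck k ('D_(e_ i) f).
Proof. by case=> _ /(_ i)[]. Qed.

Lemma is_Ck_is_derive k f x i : is_Ck k.+1 f -> is_derive x (e_ i) f ('D_(e_ i) f x).
Proof. by move=> fk; exact/derivableP/is_Ck_derivable/fk. Qed.

(** Supplying candidate partial derivatives reduces each closure property of C^k to an induction on
    k and a pointwise differentiation rule. *)
Lemma is_CkS k f (df : 'I_n -> 'rV[R]_n -> R) : continuous f ->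
  (forall i x, is_derive x (e_ i) f (df i x)) -> (forall i, is_Ck k (df i)) ->
  is_Ck k.+1 f.
Proof.
move=> cf Hdf Hk; split=> // i; split; first by move=> x; case: (Hdf i x).
suff -> : 'D_(e_ i) f = df i by exact: Hk.
by apply/funext => x; case: (Hdf i x).
Qed.

Lemma is_Ck_cst k (c : R) : is_Ck k (fun _ : 'rV[R]_n => c).
Proof.
elim: k c => [|k IH] c; first exact: cst_continuous.
apply: (is_CkS (df := fun _ _ => 0)); first exact: cst_continuous.
by move=> i; exact: IH.
Qed.

Lemma is_CkD k f g : is_Ck k f -> is_Ck k g -> is_Ck k (fun x => f x + g x).
Proof.
elim: k f g => [|k IH] f g fk gk.
  by move=> x; apply: continuousD; [exact: fk|exact: gk].
apply: (is_CkS (df := fun i x => 'D_(e_ i) f x + 'D_(e_ i) g x)).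
- by move=> x; apply: continuousD; apply: is_Ck_continuous; eassumption.
- by move=> i x; apply: is_deriveD; apply: is_Ck_is_derive; eassumption.
- by move=> i; apply: IH; exact: is_Ck_derive.
Qed.

Lemma is_CkM k f g : is_Ck k f -> is_Ck k g -> is_Ck k (fun x => f x * g x).
Proof.
elim: k f g => [|k IH] f g fk gk.
  by move=> x; apply: continuousM; [exact: fk|exact: gk].
apply: (is_CkS (df := fun i x => f x * 'D_(e_ i) g x + g x * 'D_(e_ i) f x)).
- by move=> x; apply: continuousM; apply: is_Ck_continuous; eassumption.
- by move=> i x; apply: is_deriveM; apply: is_Ck_is_derive; eassumption.
- by move=> i; apply: is_CkD; apply: IH; (exact: is_Ck_derive || exact: is_CkW).
Qed.

Lemma is_derive_coord x i j : is_derive x (e_ j) (fun x => x ord0 i) ((e_ j) ord0 i).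
Proof.
apply/is_derive_lineP.
have -> : (fun h : R => (h *: e_ j + x) ord0 i) =
          (id : R -> R) * cst ((e_ j) ord0 i) + cst (x ord0 i).
  by apply/funext => h; rewrite !mxE.
apply: is_derive_eq.
by rewrite scaler0 add0r addr0 /GRing.scale/= mulr1.
Qed.

Lemma is_Ck_coord k i : is_Ck k (fun x : 'rV[R]_n => x ord0 i).
Proof.
case: k => [|k]; first exact: coord_continuous.
apply: (is_CkS (df := fun j _ => (e_ j) ord0 i)); first exact: coord_continuous.
  by move=> j x; exact: is_derive_coord.
by move=> j; exact: is_Ck_cst.
Qed.

Lemma is_Ck_sum k (I : Type) (r : seq I) (F : I -> 'rV[R]_n -> R) :
  (forall j, is_Ck k (F j)) -> is_Ck k (fun x => \sum_(j <- r) F j x).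
Proof.
move=> Fk; elim: r => [|i r IH].
  by under eq_fun do rewrite big_nil; exact: is_Ck_cst.
by under eq_fun do rewrite big_cons; exact: is_CkD.
Qed.

Lemma laplacian_continuous f : is_Ck 2 f -> continuous (laplacian f).
Proof.
move=> f2; apply: (@is_Ck_continuous 0); apply: is_Ck_sum => i.
by do 2 apply: is_Ck_derive.
Qed.

Lemma deriveM2 f g i x : is_Ck 2 f -> is_Ck 2 g ->
  'D_(e_ i) ('D_(e_ i) (fun x => f x * g x)) x =
  f x * 'D_(e_ i) ('D_(e_ i) g) x + 2 * ('D_(e_ i) f x * 'D_(e_ i) g x)
    + g x * 'D_(e_ i) ('D_(e_ i) f) x.
Proof.
move=> f2 g2.
have -> : 'D_(e_ i) (fun x => f x * g x) =
    (fun x => f x * 'D_(e_ i) g x) + (fun x => g x * 'D_(e_ i) f x).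
  by apply/funext => y; rewrite deriveM//; apply: is_Ck_derivable; eassumption.
have [f1 g1] := (is_Ck_derive i f2, is_Ck_derive i g2).
have [df dg] := (is_Ck_is_derive x i f2, is_Ck_is_derive x i g2).
have [ddf ddg] := (is_Ck_is_derive x i f1, is_Ck_is_derive x i g1).
have [_ ->] := is_deriveD (is_deriveM df ddg) (is_deriveM dg ddf).
rewrite /GRing.scale /=.
move: ('D_ _ _ x) ('D_ _ _ x) ('D_ _ _ x) ('D_ _ _ x) => a b c d; ring.
Qed.

Lemma laplacianM f g x : is_Ck 2 f -> is_Ck 2 g ->
  laplacian (fun x => f x * g x) x = f x * laplacian g x +
    2 * \sum_(i < n) ('D_(e_ i) f x * 'D_(e_ i) g x) + g x * laplacian f x.
Proof.
move=> f2 g2; rewrite /laplacian !mulr_sumr -!big_split /=.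
by apply: eq_bigr => i _; rewrite deriveM2.
Qed.

Lemma laplacianD f g x : is_Ck 2 f -> is_Ck 2 g ->
  laplacian (fun x => f x + g x) x = laplacian f x + laplacian g x.
Proof.
move=> f2 g2; rewrite /laplacian -big_split /=; apply: eq_bigr => i _.
have -> : 'D_(e_ i) (fun x => f x + g x) = 'D_(e_ i) f + 'D_(e_ i) g.
  by apply/funext => y; rewrite deriveD//; apply: is_Ck_derivable; eassumption.
by rewrite deriveD//; apply: is_Ck_derivable; apply: is_Ck_derive; eassumption.
Qed.

Lemma laplacian_cst (k : R) x : laplacian (fun _ : 'rV[R]_n => k) x = 0.
Proof.
rewrite /laplacian big1// => i _.
have -> : 'D_(e_ i) (fun _ : 'rV[R]_n => k) = cst 0 by apply/funext => y; exact: derive_cst.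
exact: derive_cst.
Qed.

Lemma laplacianZ (k : R) f x : is_Ck 2 f ->
  laplacian (fun x : 'rV[R]_n => k * f x) x = k * laplacian f x.
Proof.
move=> f2; rewrite (laplacianM x (is_Ck_cst 2 k) f2) laplacian_cst mulr0 addr0 big1 ?mulr0 ?addr0// => i _.
by have -> : 'D_(e_ i) (fun _ : 'rV[R]_n => k) x = 0; [exact: derive_cst|rewrite mul0r].
Qed.

Lemma laplacian_min f x : is_Ck 2 f -> (\forall z \near x, f x <= f z) ->
  (forall i, 'D_(e_ i) f x = 0) /\ 0 <= laplacian f x.
Proof.
move=> f2 fmin.
have H i : 'D_(e_ i) f x = 0 /\ 0 <= 'D_(e_ i) ('D_(e_ i) f) x.
  have df : (\forall z \near x, derivable f z (e_ i)).
    by near=> z; exact: is_Ck_derivable f2.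
  have ddf : derivable ('D_(e_ i) f) x (e_ i).
    by apply: is_Ck_derivable; exact: is_Ck_derive f2.
  exact: derive2_min df ddf fmin.
by split=> [i|]; [case: (H i)|apply: sumr_ge0 => i _; case: (H i)].
Unshelve. all: by end_near. Qed.

End Ck_functions.

#[local] Opaque is_Ck.

(** * Cubes as carriers of compact supports *)

Section boxes.
Context {R : realType} {n : nat}.
Implicit Types (a x : 'rV[R]_n) (r : R).

(** Cubes are products of intervals, so compactness, measurability and volume reduce to one
    coordinate. Compact support is expressed below as vanishing outside some [box a r]. *)
Definition box a r : set 'rV[R]_n := [set x | forall i, `|x ord0 i - a ord0 i| <= r].

Lemma compact_box a r : compact (box a r).
Proof.
have -> : box a r = [set x : 'rV[R]_n |
    forall i, `[a ord0 i - r, a ord0 i + r]%classic (x ord0 i)].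
  apply/seteqP; split=> x /= H i; have := H i; rewrite /= in_itv/=;
    by rewrite ler_distl.
by apply: (rV_compact (A := fun i => `[a ord0 i - r, a ord0 i + r]%classic)) => i;
  exact: segment_compact.
Qed.

Lemma closed_box a r : closed (box a r).
Proof. by apply: compact_closed (@compact_box a r); exact: norm_hausdorff. Qed.

Lemma nbhs_box a (A : set 'rV[R]_n) : nbhs a A -> exists2 r, 0 < r & box a r `<=` A.
Proof.
move=> /nbhs_ballP[e /= e0 eA]; exists (e / 2); first by rewrite divr_gt0.
move=> x xe; apply: eA; split=> // i j; rewrite ord1 /ball/= distrC.
by rewrite (le_lt_trans (xe j))// ltr_pdivrMr// mulr_natr mulr2n ltrDl.
Qed.

Lemma test_function_box phi a r : (forall k, is_Ck k phi) ->
  (forall x, ~ box a r x -> phi x = 0) -> test_function phi.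
Proof.
move=> phik phi0; split; first exact: phik.
apply: (subclosed_compact _ (@compact_box a r)); first exact: closed_closure.
have /closure_id -> := @closed_box a r.
by apply: closureS => x /= /eqP phix; apply: contrapT => /phi0.
Qed.

Lemma derive_notin_box (f : 'rV[R]_n -> R) v a r :
  (forall x, ~ box a r x -> f x = 0) -> forall x, ~ box a r x -> 'D_v f x = 0.
Proof.
move=> f0 x xb; rewrite -[RHS](derive_cst (0 : R) x v); apply: near_eq_derive.
have : nbhs x (~` box a r).
  by apply: open_nbhs_nbhs; split=> //; exact/closed_openC/closed_box.
by apply: filterS => z /f0.
Qed.

End boxes.

(** * The squared Euclidean distance and its derivatives *)

Section squared_distance.
Context {R : realType} {n : nat}.
Implicit Types (a x : 'rV[R]_n).
Local Notation e_ i := (delta_mx ord0 i : 'rV[R]_n).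

(** The norm of row vectors is the maximum norm, which is not smooth. This polynomial supplies the
    radial functions needed for the bump and for both barriers. *)
Definition sqdist a x : R := \sum_(i < n) (x ord0 i - a ord0 i) * (x ord0 i - a ord0 i).

Lemma sqdist_ge0 a x : 0 <= sqdist a x.
Proof. by apply: sumr_ge0 => i _; rewrite -expr2 sqr_ge0. Qed.

Lemma sqdistxx a : sqdist a a = 0.
Proof. by rewrite /sqdist big1// => i _; rewrite subrr mulr0. Qed.

Lemma sqr_coord_le_sqdist a x i : `|x ord0 i - a ord0 i| ^+ 2 <= sqdist a x.
Proof.
rewrite real_normK ?num_real// /sqdist (bigD1 i)//= expr2 lerDl.
by apply: sumr_ge0 => j _; rewrite -expr2 sqr_ge0.
Qed.

Lemma is_Ck_sqdist a k : is_Ck k (sqdist a).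
Proof.
apply: is_Ck_sum => i; apply: is_CkM;
  by apply: is_CkD; [exact: is_Ck_coord|exact: is_Ck_cst].
Qed.

Lemma is_derive_sqdist a x i :
  is_derive x (e_ i) (sqdist a) (2 * (x ord0 i - a ord0 i)).
Proof.
pose F (j : 'I_n) : 'rV[R]_n -> R := (fun x => x ord0 j) - cst (a ord0 j).
have -> : sqdist a = \sum_(j < n) (F j * F j).
  by apply/funext => y; rewrite /sqdist fct_sumE.
have DF j : is_derive x (e_ i) (F j) ((e_ i) ord0 j).
  apply: is_derive_eq (is_deriveB (is_derive_coord x j i) (is_derive_cst _ _ _)) _.
  by rewrite subr0.
have D j : is_derive x (e_ i) (F j * F j) ((i == j)%:R * (2 * (x ord0 j - a ord0 j))).
  apply: is_derive_eq (is_deriveM (DF j) (DF j)) _.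
  by rewrite -[F j x]/(x ord0 j - a ord0 j) mxE eqxx/= (eq_sym j) /GRing.scale/=; ring.
apply: is_derive_eq (is_derive_sum D) _.
rewrite (bigD1 i)//= eqxx mul1r big1 ?addr0// => j ji.
by rewrite eq_sym (negPf ji) mul0r.
Qed.

Lemma derive_sqdist a x i : 'D_(e_ i) (sqdist a) x = 2 * (x ord0 i - a ord0 i).
Proof. by have [] := is_derive_sqdist a x i. Qed.

Lemma is_derive2_sqdist a x i : is_derive x (e_ i) ('D_(e_ i) (sqdist a)) 2.
Proof.
have -> : 'D_(e_ i) (sqdist a) = 2 \*: ((fun x => x ord0 i) - cst (a ord0 i)).
  by apply/funext => y; rewrite derive_sqdist.
apply: is_derive_eq (is_deriveZ 2 (is_deriveB (is_derive_coord x i i) (is_derive_cst _ _ _))) _.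
by rewrite !mxE !eqxx subr0 /GRing.scale/= mulr1.
Qed.

Lemma laplacian_sqdist (a x : 'rV[R]_n) : laplacian (sqdist a) x = 2 * n%:R.
Proof.
rewrite /laplacian (eq_bigr (fun=> 2)) => [|i _]; last by have [] := is_derive2_sqdist a x i.
by rewrite sumr_const card_ord mulr_natr.
Qed.

(** The radius t + 1 avoids a square root: y^2 <= t implies y <= y^2 + 1 <= t + 1. *)
Lemma sqdist_le_box a t : [set x | sqdist a x <= t] `<=` box a (t + 1).
Proof.
move=> x /= xt i; have := sqr_coord_le_sqdist a x i => /le_trans/(_ xt).
by nra.
Qed.

Lemma compact_sqdist a (I : set R) t : closed I -> (forall r, I r -> r <= t) ->
  compact (sqdist a @^-1` I).
Proof.
move=> cI It; apply: (subclosed_compact _ (@compact_box _ _ a (t + 1))).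
  apply: closed_comp => // x _; exact: (is_Ck_continuous (is_Ck_sqdist a 0)).
by move=> x /It; exact: sqdist_le_box.
Qed.

End squared_distance.

(** * A smooth bump function *)

Section bump.
Context {R : realType}.
Implicit Types (P : {poly R}) (s : R).

(* Functions P(1/s) exp(-1/s) extended by 0 are stable under derivation, hence
   smooth. *)
Definition flat P s : R := if 0 < s then P.[s^-1] * expR (- s^-1) else 0.

Lemma horner_le_expR P : exists C : R, forall y, 0 <= y -> `|P.[y]| <= C * expR y.
Proof.
exists (\sum_(i < size P) `|P`_i| * (i`!)%:R) => y y0.
rewrite horner_coef (le_trans (ler_norm_sum _ _ _))// mulr_suml ler_sum// => i _.
rewrite normrM -mulrA ler_wpM2l// normrX ger0_norm//.
have f0 : 0 < (i`!)%:R :> R by rewrite ltr0n fact_gt0.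
rewrite mulrC -ler_pdivrMr//.
case: (nat_of_ord i) => [|m].
  by rewrite expr0 fact0 divr1; have := expR_ge1Dx y; apply: le_trans; rewrite lerDl.
by apply: le_trans (expR_ge1Dxn m y0); rewrite lerDr.
Qed.

(** The exponential bound for P X^2 at 1/s gives |P(1/s)| s^-2 <= C exp(1/s). The quadratic decay is
    what makes the derivative at 0 exist and vanish. *)
Lemma flat_le_sqr P : exists C : R, forall s, `|flat P s| <= C * s ^+ 2.
Proof.
have [C HC] := horner_le_expR (P * 'X^2); exists `|C| => s; rewrite /flat.
case: ifPn => s0; last by rewrite normr0 mulr_ge0// sqr_ge0.
have := HC s^-1; rewrite invr_ge0 ltW// => /(_ isT).
rewrite hornerM hornerXn [X in X <= _ -> _]normrM normrX => H; rewrite normrM.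
rewrite [X in _ * X <= _]ger0_norm ?expR_ge0// expRN.
rewrite ler_pdivrMr ?expR_gt0//.
rewrite [`|s^-1|]ger0_norm ?invr_ge0 ?(ltW s0)// exprVn ler_pdivrMr ?exprn_gt0// in H.
apply: le_trans H _; rewrite mulrAC ler_wpM2r ?expR_ge0//.
by rewrite ler_wpM2r ?ler_norm// sqr_ge0.
Qed.

(** For s > 0 the chain rule gives (P' - P)(1/s) exp(-1/s) times - s^-2, and the last factor becomes
    the polynomial factor X^2 in 1/s. *)
Lemma is_derive_flat P s : is_derive s 1 (flat P) (flat ('X^2 * (P - P^`())) s).
Proof.
have [s0|s0|->] := ltgtP s 0.
- have neg Q z : z < 0 -> flat Q z = 0 by move=> z0; rewrite /flat ltNge (ltW z0).
  rewrite neg//; apply: (near_eq_is_derive (f := fun=> 0)).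
  by near=> z; rewrite neg//; near: z; exact: lt_nbhsl.
- have Ds : is_derive s 1 (fun z : R => z^-1) (- s ^- 2).
    by apply: is_derive_eq (is_deriveV (f := id) _ _) _ => //; [rewrite gt_eqF|rewrite scaler1].
  pose g (z : R) := P.[z] * expR (- z).
  have Dg : is_derive s^-1 1 g ((P^`() - P).[s^-1] * expR (- s^-1)).
    have E : is_derive s^-1 1 (fun z : R => expR (- z)) (- expR (- s^-1)).
      apply: is_derive_eq (is_derive1_comp (f := expR) (g := -%R) _ _) _.
      by rewrite mulrN1.
    apply: is_derive_eq (is_deriveM (is_derive_poly P s^-1) E) _.
    by rewrite /GRing.scale/= hornerD hornerN; ring.
  have DF := is_derive1_comp Dg Ds.
  have -> : flat ('X^2 * (P - P^`())) s =
      (P^`() - P).[s^-1] * expR (- s^-1) * - s ^- 2.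
    by rewrite /flat s0 hornerM hornerXn !hornerD !hornerN exprVn; ring.
  apply: near_eq_is_derive DF; near=> z.
  by rewrite /flat/= ifT//; near: z; exact: lt_nbhsr.
- have [C HC] := flat_le_sqr P.
  have f0 Q : flat Q 0 = 0 by rewrite /flat ltxx.
  (* The slope function takes the value 0 at z = 0, and it is continuous there because the quadratic
     bound makes it O(|z|). *)
  apply/is_derive1_caratheodory; exists (fun z => flat P z / z); split.
  + move=> z; rewrite f0 !subr0.
    have [->|z0] := eqVneq z 0; first by rewrite f0 mulr0.
    by rewrite divfK.
  + rewrite /prop_for /continuous_at f0 mul0r; apply/cvgr0Pnorm_lt => e e0; near=> z => /=.
    have C0 : 0 < `|C| + 1 by rewrite ltr_wpDl.
    have ze : `|z| * (`|C| + 1) < e.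
      by rewrite -ltr_pdivlMr//; near: z; apply: (@cvgr0_norm_lt _ _ _ _ _ id cvg_id); rewrite divr_gt0// ltr_wpDl.
    have [->|z0] := eqVneq z 0; first by rewrite f0 mul0r normr0.
    rewrite normrM normfV ltr_pdivrMr ?normr_gt0//.
    apply: le_lt_trans (HC z) _; rewrite -real_normK ?num_real// expr2 mulrA.
    rewrite ltr_pM2r ?normr_gt0//; apply: le_lt_trans ze.
    by rewrite mulrC ler_wpM2l// (le_trans (ler_norm _))// lerDl.
  + by rewrite !f0 mul0r.
Unshelve. all: by end_near. Qed.

Lemma continuous_flat P : continuous (flat P).
Proof.
move=> s; apply: differentiable_continuous; apply/derivable1_diffP.
by case: (is_derive_flat P s).
Qed.

Lemma is_Ck_flat_comp n P (q : 'rV[R]_n -> R) k : (forall j, is_Ck j q) ->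
  is_Ck k (fun x => flat P (q x)).
Proof.
move=> qk; elim: k P => [|k IH] P.
  by move=> x; apply: continuous_comp; [exact: (qk 0)|exact: continuous_flat].
apply: (is_CkS (df := fun i x => flat ('X^2 * (P - P^`())) (q x) *
    'D_(delta_mx ord0 i) q x)).
- by move=> x; apply: continuous_comp; [exact: (qk 0)|exact: continuous_flat].
- move=> i x; apply: is_derive_comp_real; first exact: is_derive_flat.
  exact: is_Ck_is_derive (qk 1).
- by move=> i; apply: is_CkM => //; exact: is_Ck_derive (qk k.+1).
Qed.

(** The witness exp(- 1 / (r^2 - |x - a|^2)) is positive exactly on the Euclidean ball of radius r,
    which the cube of the same radius contains. *)
Lemma bump_function n (a : 'rV[R]_n) (r : R) : 0 < r -> exists phi : 'rV[R]_n -> R,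
  [/\ forall k, is_Ck k phi, forall x, 0 <= phi x, 0 < phi a &
      forall x, ~ box a r x -> phi x = 0].
Proof.
move=> r0.
pose q x := r ^+ 2 + -1 * sqdist a x.
have qk k : is_Ck k q.
  apply: is_CkD; first exact: is_Ck_cst.
  by apply: is_CkM; [exact: is_Ck_cst|exact: is_Ck_sqdist].
exists (fun x => flat 1 (q x)); split.
- by move=> k; exact: is_Ck_flat_comp.
- by move=> x; rewrite /flat; case: ifP => // _; rewrite hornerC mul1r expR_ge0.
- rewrite /flat ifT ?hornerC ?mul1r ?expR_gt0//.
  by rewrite /q sqdistxx mulr0 addr0 exprn_gt0.
- move=> x /existsNP[i /negP]; rewrite -ltNge => xi.
  rewrite /flat ifF//; apply/negbTE; rewrite -leNgt /q mulN1r subr_le0.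
  by apply: le_trans (sqr_coord_le_sqdist a x i); rewrite ler_sqr ?nnegrE// ltW.
Qed.

End bump.

(** * Pointwise bounds and the Liouville property *)

Section a_priori_bound.
Context {R : realType} {n : nat}.
Implicit Types (U V c : 'rV[R]_n -> R) (x : 'rV[R]_n).
Local Notation e_ i := (delta_mx ord0 i : 'rV[R]_n).

(* Keller-Osserman: the barrier q = t - |x - a|^2 localizes the minimum of
   c q^2, where the differential inequality bounds - c(a) t; then t grows. *)
Lemma ge0_of_laplacian_le c : is_Ck 2 c ->
  (forall x, c x < 0 -> laplacian c x <= - (2 * c x ^+ 2)) -> forall x, 0 <= c x.
Proof.
move=> c2 cle a; rewrite leNgt; apply/negP => ca0.
(* At the minimum y, 0 <= Delta (c q^2) becomes - c(y) q(y)^2 <= 2 n q(y) + 12 |y - a|^2. The 12 is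
   half of 32 - 8: the cross term 2 grad c . grad q^2 contributes - 32 c |y - a|^2 and c Delta q^2
   contributes 8 c |y - a|^2. Since q(y) and |y - a|^2 are both at most t, dividing by t gives the
   bound. *)
suff bnd (t : R) : 0 < t -> - c a * t <= 2 * n%:R + 12.
  pose t := (2 * n%:R + 13) / (- c a).
  have n0 : 0 <= n%:R :> R by [].
  have t0 : 0 < t by rewrite divr_gt0 ?oppr_gt0//; lra.
  have := bnd t t0; rewrite /t mulrC divfK ?oppr_eq0 ?lt_eqF//; lra.
move=> t0.
pose q x := t + (-1) * sqdist a x.
have qk k : is_Ck k q.
  apply: is_CkD; first exact: is_Ck_cst.
  by apply: is_CkM; [exact: is_Ck_cst|exact: is_Ck_sqdist].
have qE x : q x = t - sqdist a x by rewrite /q mulN1r.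
pose qq x := q x * q x.
have qq2 : is_Ck 2 qq := is_CkM (qk 2) (qk 2).
pose f x := c x * qq x.
have f2 : is_Ck 2 f := is_CkM c2 qq2.
pose K := [set x | sqdist a x <= t].
have cK : compact K.
  by apply: (compact_sqdist (I := [set r | r <= t]) (t := t)) => //; exact: closed_le.
have K0 : K !=set0 by exists a; rewrite /K/= sqdistxx ltW.
have [|y yK ymin] := EVT_min_rV K0 cK (f := f).
  exact/continuous_subspaceT/(is_Ck_continuous f2).
rewrite inE /K/= in yK.
have fa : f a = c a * t ^+ 2 by rewrite /f /qq qE sqdistxx subr0 expr2.
have fya : f y <= f a by apply: ymin; rewrite inE /K/= sqdistxx ltW.
have fa0 : f a < 0 by rewrite fa nmulr_rlt0// exprn_gt0.
(* The function f vanishes where q does, while f y <= f a < 0; hence y is not on the bounding sphere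
   and is a local minimum in the whole space. *)
have qy0 : 0 < q y.
  rewrite qE subr_gt0 lt_neqAle yK andbT; apply/eqP => E.
  by move: (le_lt_trans fya fa0); rewrite /f /qq qE E subrr mulr0 mulr0 ltxx.
have cy0 : c y < 0.
  by move: (le_lt_trans fya fa0); rewrite /f /qq pmulr_llt0// mulr_gt0.
have [D0 L0] : (forall i, 'D_(e_ i) f y = 0) /\ 0 <= laplacian f y.
  apply: laplacian_min => //.
  have : \forall z \near y, 0 < q z := is_Ck_continuous (qk 0) (lt_nbhsr qy0).
  by apply: filterS => z; rewrite qE subr_gt0 => /ltW zK; apply: ymin; rewrite inE.
have Dq i : 'D_(e_ i) q y = - 'D_(e_ i) (sqdist a) y.
  have [_ ->] := is_deriveD (is_derive_cst (t : R) y (e_ i))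
    (is_deriveM (is_derive_cst (-1 : R) y (e_ i)) (is_derive_sqdist a y i)).
  by rewrite derive_sqdist /GRing.scale/= /cst; ring.
have Dqq i : 'D_(e_ i) qq y = 2 * q y * 'D_(e_ i) q y.
  rewrite /qq [LHS]deriveM; [|exact: is_Ck_derivable (qk 1)..].
  by rewrite /GRing.scale/=; ring.
(* Criticality of c q^2 expresses the gradient of c, about which nothing is known, through that of
   q. *)
have Df i : q y * 'D_(e_ i) c y = - (2 * c y) * 'D_(e_ i) q y.
  have := D0 i; rewrite /f [LHS]deriveM; [|by apply: is_Ck_derivable; eassumption..].
  rewrite Dqq /GRing.scale/= /qq => /eqP.
  rewrite (_ : _ + _ = q y * (q y * 'D_(e_ i) c y + 2 * c y * 'D_(e_ i) q y)); last by ring.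
  by rewrite mulf_eq0 gt_eqF//= addr_eq0 => /eqP ->; rewrite mulNr.
have Lq : laplacian q y = - (2 * n%:R).
  have s2 := is_Ck_sqdist a 2.
  rewrite (laplacianD y (is_Ck_cst 2 t) (is_CkM (is_Ck_cst 2 (-1)) s2)).
  by rewrite laplacian_cst add0r (laplacianZ _ _ s2) laplacian_sqdist mulN1r.
have Sq : \sum_(i < n) 'D_(e_ i) q y * 'D_(e_ i) q y = 4 * sqdist a y.
  rewrite /sqdist mulr_sumr; apply: eq_bigr => i _.
  by rewrite Dq derive_sqdist; ring.
have Lqq : laplacian qq y = - (4 * n%:R * q y) + 8 * sqdist a y.
  by rewrite (laplacianM y (qk 2) (qk 2)) Sq Lq; ring.
have Scq : \sum_(i < n) 'D_(e_ i) c y * 'D_(e_ i) qq y = - (16 * c y * sqdist a y).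
  transitivity (\sum_(i < n) - (4 * c y) * ('D_(e_ i) q y * 'D_(e_ i) q y)).
    apply: eq_bigr => i _; rewrite Dqq.
    have -> : 'D_(e_ i) c y * (2 * q y * 'D_(e_ i) q y) =
      2 * (q y * 'D_(e_ i) c y) * 'D_(e_ i) q y by ring.
    by rewrite Df; ring.
  by rewrite -mulr_sumr Sq; ring.
have Lf : laplacian f y = c y * laplacian qq y + 2 * (- (16 * c y * sqdist a y)) + qq y * laplacian c y.
  by rewrite (laplacianM y c2 qq2) Scq.
have Lc := cle _ cy0.
have s0 := sqdist_ge0 a y; have n0 : 0 <= n%:R :> R by [].
have qyt : q y <= t by rewrite qE lerBlDr lerDl.
have H1 : qq y * laplacian c y <= qq y * - (2 * c y ^+ 2).
  by rewrite ler_wpM2l// mulr_ge0// ltW.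
have H2 : 0 <= - c y * (2 * n%:R * q y + 12 * sqdist a y + c y * qq y).
  rewrite -(pmulr_rge0 _ (ltr0n R 2)); apply: le_trans L0 _; rewrite Lf Lqq.
  apply: le_trans (lerD (lexx _) H1) _; rewrite le_eqVlt; apply/orP; left; apply/eqP.
  by rewrite /qq; ring.
rewrite pmulr_rge0 ?oppr_gt0// in H2.
have H3 : n%:R * q y <= n%:R * t by rewrite ler_wpM2l.
have H4 : - c a * t ^+ 2 <= (2 * n%:R + 12) * t.
  rewrite fa /f in fya; move: H2 H3 fya yK; rewrite mulNr; clear.
  move: (c y * qq y) (c a * t ^+ 2) (q y) (n%:R) (sqdist a y) => *; lra.
by rewrite -(ler_pM2r t0); apply: le_trans H4; rewrite expr2 mulrA.
Qed.

End a_priori_bound.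

(** * The iterated logarithm used as barrier *)

Section log_log.
Context {R : realType}.
Variable rho : R.
Hypothesis rho0 : 0 < rho.
Implicit Types t : R.

(** The argument t stands for a squared distance. Dividing by rho and adding 1 make the function
    vanish at rho and stay well defined and nonnegative for t >= rho. *)
Definition loglog t : R := ln (1 + ln (t / rho)).

Let ln_ge0' t : rho <= t -> 0 <= ln (t / rho).
Proof. by move=> rt; rewrite ln_ge0// ler_pdivlMr// mul1r. Qed.

Let L t : R := 1 + ln (t / rho).

Let L_gt0 t : rho <= t -> 0 < L t.
Proof. by move=> /ln_ge0'; rewrite /L; lra. Qed.

Let is_derive_L t : rho <= t -> is_derive t 1 L t^-1.
Proof.
move=> rt; have t0 : 0 < t := lt_le_trans rho0 rt.
have D1 : is_derive t 1 (fun z : R => z / rho) rho^-1.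
  apply: is_derive_eq (is_deriveM (is_derive_id t 1) (is_derive_cst (rho^-1) t 1)) _.
  by rewrite scaler0 add0r /GRing.scale/= mulr1.
have tr0 : 0 < t / rho by rewrite divr_gt0.
have -> : L = cst 1 + (@ln R \o (fun z => z / rho)) by [].
have D2 := is_derive1_comp (f := @ln R) (g := fun z => z / rho) (is_derive1_ln tr0) D1.
have D3 := is_derive_cst (1 : R) t 1.
have D4 := is_deriveD D3 D2.
apply: is_derive_eq D4 _.
by rewrite add0r invf_div mulrAC divff ?gt_eqF// div1r.
Qed.

Lemma is_derive_loglog t : rho <= t -> is_derive t 1 loglog (t * (1 + ln (t / rho)))^-1.
Proof.
move=> rt.
apply: is_derive_eq (is_derive1_comp (is_derive1_ln (L_gt0 rt)) (is_derive_L rt)) _.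
by rewrite -invfM mulrC.
Qed.

Lemma is_derive2_loglog t : rho <= t ->
  is_derive t 1 (fun t => (t * (1 + ln (t / rho)))^-1)
    (- (2 + ln (t / rho)) / (t * (1 + ln (t / rho))) ^+ 2).
Proof.
move=> rt; have t0 : 0 < t := lt_le_trans rho0 rt.
have D1 := is_deriveM (is_derive_id t 1) (is_derive_L rt).
have N0 : (id * L) t != 0 by rewrite mulf_neq0 ?gt_eqF// L_gt0.
apply: is_derive_eq (is_deriveV N0 D1) _.
rewrite -[(id * L) t]/(t * L t) /L /GRing.scale/= mulr1 divff ?gt_eqF//.
by rewrite addrA !mulNr mulrC.
Qed.

Lemma loglog_ge0 t : rho <= t -> 0 <= loglog t.
Proof. by move=> /ln_ge0' ?; rewrite ln_ge0// lerDl. Qed.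

Lemma loglog_rho : loglog rho = 0.
Proof. by rewrite /loglog divff ?gt_eqF// ln1 addr0 ln1. Qed.

Lemma loglog_unbounded t M : rho <= t -> 0 <= M -> exists T,
  t <= T /\ loglog T = M + loglog t.
Proof.
(* This T is the explicit solution of loglog T = k. *)
move=> rt M0; pose k := M + loglog t; exists (rho * expR (expR k - 1)); split.
  rewrite mulrC -ler_pdivrMr//.
  have tr : 0 < t / rho by rewrite divr_gt0// (lt_le_trans rho0).
  rewrite -[leLHS](lnK tr) ler_expR lerBrDl -[leLHS](lnK (L_gt0 rt : L t \is Num.pos)).
  by rewrite ler_expR lerDr.
by rewrite /loglog mulrAC divff ?gt_eqF// mul1r expRK addrC subrK expRK.
Qed.

End log_log.

(** * The Liouville property in dimension at most 2 *)

Section liouville.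
Context {R : realType} {n : nat}.
Implicit Types (f : 'rV[R]_n -> R) (a x : 'rV[R]_n).
Local Notation e_ i := (delta_mx ord0 i : 'rV[R]_n).

Lemma nbhs_sqdist a (A : set 'rV[R]_n) : nbhs a A ->
  exists2 t : R, 0 < t & [set x | sqdist a x <= t] `<=` A.
Proof.
move=> /nbhs_box[r r0 rA]; exists (r ^+ 2); first by rewrite exprn_gt0.
move=> x xr; apply: rA => i.
have := le_trans (sqr_coord_le_sqdist a x i) xr.
by rewrite ler_sqr ?nnegrE// ltW.
Qed.

Lemma near_sqdist_gt a (t : R) x : t < sqdist a x -> \forall z \near x, t < sqdist a z.
Proof. by move=> /(@lt_nbhsr R); exact: (is_Ck_continuous (is_Ck_sqdist a 0)). Qed.

Lemma near_sqdist_lt a (t : R) x : sqdist a x < t -> \forall z \near x, sqdist a z < t.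
Proof. by move=> /(@lt_nbhsl R); exact: (is_Ck_continuous (is_Ck_sqdist a 0)). Qed.

(* For n <= 2, |x - a| |-> log (1 + log (|x - a|^2 / rho)) is strictly
   superharmonic and unbounded, hence a barrier at infinity: f is at least its
   minimum over any small ball around a, so f a is a global minimum. *)
Lemma superharmonic_ge f : (n <= 2)%N -> is_Ck 2 f -> (forall x, 0 <= f x) ->
  (forall x, laplacian f x <= 0) -> forall a x, f a <= f x.
Proof.
move=> n2 f2 f0 Lf a x; rewrite leNgt; apply/negP => fxa.
pose m := (f x + f a) / 2.
have fxm : f x < m by rewrite /m; lra.
have mfa : m < f a by rewrite /m; lra.
have m0 : 0 < m by apply: le_lt_trans fxm.
have [rho rho0 Hrho] := nbhs_sqdist (is_Ck_continuous f2 (lt_nbhsr mfa)).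
have rx : rho < sqdist a x.
  by rewrite ltNge; apply/negP => /Hrho/=; rewrite ltNge (ltW fxm).
(* Small enough that the barrier keeps W x below m. On the inner sphere the barrier is 0 and f > m,
   so the minimum of W cannot lie there. *)
pose eps := (m - f x) / (2 * (loglog rho (sqdist a x) + 1)).
have B0 := loglog_ge0 rho0 (ltW rx).
have eps0 : 0 < eps by rewrite divr_gt0 ?subr_gt0// mulr_gt0// ltr_wpDl.
have epsx : f x + eps * loglog rho (sqdist a x) < m.
  rewrite -ltrBrDl /eps mulrAC ltr_pdivrMr; last by rewrite mulr_gt0// ltr_wpDl.
  rewrite ltr_pM2l ?subr_gt0//; lra.
(* The increment m / eps makes eps times the barrier at least m on the outer sphere; as f >= 0, the
   minimum of W cannot lie there either. *)
have [T [xT ET]] := loglog_unbounded rho0 (ltW rx) (ltW (divr_gt0 m0 eps0)).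
pose W z := f z + eps * loglog rho (sqdist a z).
pose K := [set z | rho <= sqdist a z <= T].
have cK : compact K.
  have -> : K = sqdist a @^-1` `[rho, T]%classic.
    by apply/seteqP; split=> z; rewrite /K/= in_itv/=.
  apply: (@compact_sqdist _ _ a _ T); first exact: interval_closed.
  by move=> r /=; rewrite in_itv/= => /andP[].
have Kx : K x by rewrite /K/= ltW.
have [|y yK ymin] := EVT_min_rV (f := W) (ex_intro _ x Kx) cK.
  apply: continuous_in_subspaceT => z; rewrite inE /K/= => /andP[rz _].
  have cB : loglog rho (sqdist a t) @[t --> z] --> loglog rho (sqdist a z).
    apply: (@continuous_comp _ _ _ (sqdist a) (loglog rho)).
      exact: (is_Ck_continuous (is_Ck_sqdist a 0)).
    apply: differentiable_continuous; apply/derivable1_diffP.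
    by case: (is_derive_loglog rho0 rz).
  exact: (cvgD (is_Ck_continuous f2 (x := z)) (cvgM (cvg_cst eps) cB)).
have Wym : W y < m by apply: le_lt_trans epsx; apply: ymin; rewrite inE.
move: yK; rewrite inE /K/= => /andP[ry yT].
have ry' : rho < sqdist a y.
  rewrite lt_neqAle ry andbT; apply/eqP => E; move: Wym.
  rewrite /W -E loglog_rho// mulr0 addr0 ltNge; apply/negP; rewrite negbK.
  by apply/ltW/Hrho; rewrite /= -E.
have yT' : sqdist a y < T.
  rewrite lt_neqAle yT andbT; apply/eqP => E; move: Wym.
  rewrite /W E ET ltNge; apply/negP; rewrite negbK mulrDr mulrCA divff ?gt_eqF// mulr1.
  have := mulr_ge0 (ltW eps0) B0; have := f0 y; lra.
have yW : \forall z \near y, W y <= W z.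
  near=> z; apply: ymin; rewrite inE /K/=; apply/andP; split; apply: ltW; near: z.
    exact: near_sqdist_gt.
  exact: near_sqdist_lt.
pose l z := 1 + ln (sqdist a z / rho).
have l1 : 1 <= l y by rewrite lerDl ln_ge0// ler_pdivlMr// mul1r.
pose s := sqdist a.
have DW z i : rho <= s z -> is_derive z (e_ i) W
    ('D_(e_ i) f z + eps * ((s z * l z)^-1 * (2 * (z ord0 i - a ord0 i)))).
  move=> rz; have Ds := is_derive_sqdist a z i.
  have DB := is_derive_comp_real (is_derive_loglog rho0 rz) Ds.
  exact: is_deriveD (is_Ck_is_derive z i f2) (is_deriveZ eps DB).
have DDW i : is_derive y (e_ i) ('D_(e_ i) W) ('D_(e_ i) ('D_(e_ i) f) y +
    eps * (- (1 + l y) / (s y * l y) ^+ 2 * (4 * ((y ord0 i - a ord0 i) * (y ord0 i - a ord0 i))) +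
           2 * (s y * l y)^-1)).
  (* The formula for the first derivative holds only where the squared distance is at least rho, so
     it is differentiated as an identity near y. *)
  have nearE : (\forall z \near y, (('D_(e_ i) f) +
     eps \*: (((fun t => (t * (1 + ln (t / rho)))^-1) \o s) * 'D_(e_ i) s)) z = 'D_(e_ i) W z).
    near=> z; have rz : rho <= s z by apply: ltW; near: z; exact: near_sqdist_gt.
    by have [_ ->] := DW z i rz; rewrite -derive_sqdist.
  apply: near_eq_is_derive nearE _.
  have D1 := is_derive_comp_real (is_derive2_loglog rho0 ry) (is_derive_sqdist a y i).
  have D2 := is_deriveM D1 (is_derive2_sqdist a y i).
  have D3 := is_Ck_is_derive y i (is_Ck_derive i f2).
  apply: is_derive_eq (is_deriveD D3 (is_deriveZ eps D2)) _.
  rewrite derive_sqdist -[(_ \o _) y]/((s y * l y)^-1) -/(s y) /l /GRing.scale/=.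
  by move: (_ ^-1) (_ ^-1) => u w; ring.
have D2_ge0 i : 0 <= 'D_(e_ i) ('D_(e_ i) W) y.
  have df : (\forall z \near y, derivable W z (e_ i)).
    near=> z; have rz : rho <= s z by apply: ltW; near: z; exact: near_sqdist_gt.
    by case: (DW z i rz).
  have ddf : derivable ('D_(e_ i) W) y (e_ i) by case: (DDW i).
  by case: (derive2_min df ddf yW).
have sy0 : 0 < s y := lt_trans rho0 ry'.
have ly0 : 0 < l y by apply: lt_le_trans l1.
(* The Laplacian of the barrier B(s) at y, namely B''(s) |grad s|^2 + B'(s) Delta s with |grad s|^2
   = 4 s and Delta s = 2 n. *)
pose b := - (1 + l y) / (s y * l y) ^+ 2 * (4 * s y) + 2 * n%:R * (s y * l y)^-1.
have LW : \sum_(i < n) 'D_(e_ i) ('D_(e_ i) W) y = laplacian f y + eps * b.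
  have E i := @derive_val _ _ _ _ _ _ _ (DDW i).
  rewrite (eq_bigr _ (fun i _ => E i)) big_split/=; congr (_ + _).
  rewrite -mulr_sumr big_split/= -!mulr_sumr sumr_const card_ord /b.
  by congr (_ * (_ + _)); rewrite -mulr_natr; ring.
have : 0 <= laplacian f y + eps * b by rewrite -LW; exact: sumr_ge0.
(* The dimension enters here: n <= 2 gives 2 n l <= 4 l, so the numerator is at most - 4. *)
have b0 : b < 0.
  have -> : b = (2 * n%:R * l y - 4 * (1 + l y)) / (s y * l y * l y).
    by rewrite /b; field; rewrite !gt_eqF.
  rewrite ltr_pdivrMr ?mulr_gt0// mul0r subr_lt0.
  have n2' : n%:R <= 2 :> R by rewrite (ler_nat _ _ 2).
  have : n%:R * l y <= 2 * l y by rewrite ler_pM2r.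
  lra.
have : eps * b < 0 by rewrite pmulr_rlt0.
have := Lf y; lra.
Unshelve. all: by end_near. Qed.

Lemma superharmonic_cst f : (n <= 2)%N -> is_Ck 2 f -> (forall x, 0 <= f x) ->
  (forall x, laplacian f x <= 0) -> forall a x, f x = f a.
Proof.
by move=> n2 f2 f0 Lf a x; apply/eqP; rewrite eq_le !superharmonic_ge.
Qed.

End liouville.

(** * Integration by parts for the iterated Lebesgue measure *)

Section borel_boxes.
Context {R : realType} {n : nat}.
Implicit Types (a x : 'rV[R]_n) (r : R).

Lemma measurable_box a r : measurable (box a r).
Proof.
have -> : box a r = \bigcap_(i in [set: 'I_n])
    ((fun x : 'rV[R]_n => x ord0 i : measurableTypeR R) @^-1` `[a ord0 i - r, a ord0 i + r]%classic).
  apply/seteqP; split=> x /= H i; first by move=> _; rewrite /= in_itv/= -ler_distl H.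
  by have := H i I; rewrite /= in_itv/= -ler_distl.
apply: fin_bigcap_measurable => // i _.
by rewrite -[X in measurable X]setTI; exact: measurable_rV_coord.
Qed.

(** The sigma-algebra is generated by the coordinates, so an open set has to be exhibited as a
    countable union of cubes with rational centres and radii 1/(m+1). A cube that leaves A is
    replaced by the empty set, which keeps the index type countable. *)
Lemma open_measurable_rV (A : set 'rV[R]_n) : open A -> measurable A.
Proof.
move=> oA.
pose F (p : 'rV[rat]_n * nat) : set 'rV[R]_n :=
  if `[< box (map_mx ratr p.1) p.2.+1%:R^-1 `<=` A >]
  then box (map_mx ratr p.1) p.2.+1%:R^-1 else set0.
have -> : A = \bigcup_p F p.
  apply/seteqP; split=> x; last by case=> p _; rewrite /F; case: asboolP => // + ?; apply.
  move=> Ax; have /nbhs_ballP[e /= e0 eA] : nbhs x A by exact: open_nbhs_nbhs.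
  have [m me] : exists m : nat, m.+1%:R^-1 < e / 2.
    have := near_infty_natSinv_lt (PosNum (divr_gt0 e0 (ltr0n R 2))).
    by case=> m _ /(_ m (leqnn m)) ?; exists m.
  have d0 : 0 < m.+1%:R^-1 :> R by rewrite invr_gt0.
  have /choice[q Hq] : forall i, exists q : rat, `|x ord0 i - ratr q| <= m.+1%:R^-1.
    move=> i; have [] := @rat_in_itvoo R (x ord0 i - m.+1%:R^-1) (x ord0 i + m.+1%:R^-1).
      by rewrite ltrD2l gtrN.
    by move=> q; rewrite in_itv/= => /andP[q1 q2]; exists q; rewrite ler_distlC !ltW.
  exists (\row_i q i, m) => //; rewrite /F /=.
  have xb : box (map_mx ratr (\row_i q i)) m.+1%:R^-1 x by move=> i; rewrite !mxE.
  case: asboolP => // -[z zb]; apply: eA; split=> // i j; rewrite ord1 /ball/=.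
  have := zb j; have := Hq j; rewrite !mxE => H1 H2.
  rewrite (le_lt_trans (ler_distD (ratr (q j)) _ _))//.
  rewrite [X in _ + X]distrC (splitr e) ltrD ?(le_lt_trans _ me)//.
apply: countable_bigcupT_measurable => // p; rewrite /F.
by case: ifP => _; [exact: measurable_box|exact: measurable0].
Qed.

Lemma continuous_measurable_rV (f : 'rV[R]_n -> R) : continuous f ->
  measurable_fun setT (f : 'rV[R]_n -> measurableTypeR R).
Proof.
move=> cf; apply: (measurability _ (RGenOInfty.measurableE R)).
move=> _ [_ [a ->]] <-; rewrite setTI; apply: open_measurable_rV.
move/continuousP : cf; apply; exact: interval_open.
Qed.

End borel_boxes.

Section lebesgue_boxes.
Context {R : realType}.

Lemma cons_rV_head n (p : measurableTypeR R * 'rV[R]_n) : cons_rV p ord0 ord0 = p.1.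
Proof. exact: (congr1 fst (cons_rVK p)). Qed.

Lemma cons_rV_tail n (p : measurableTypeR R * 'rV[R]_n) j :
  cons_rV p ord0 (lift ord0 j) = p.2 ord0 j.
Proof.
have := congr1 (fun x : measurableTypeR R * 'rV[R]_n => x.2 ord0 j) (cons_rVK p).
by rewrite mxE.
Qed.

Lemma box_consE n (a : 'rV[R]_n.+1) (r : R) p :
  box a r (cons_rV p) <-> `|p.1 - a ord0 ord0| <= r /\ box (uncons_rV a).2 r p.2.
Proof.
split=> [H|[H1 H2] i].
  split=> [|j]; first by rewrite -cons_rV_head.
  by rewrite mxE -cons_rV_tail.
case: (unliftP ord0 i) => [j ->|->]; last by rewrite cons_rV_head.
by rewrite cons_rV_tail; have := H2 j; rewrite mxE.
Qed.

Lemma lebesgue_box n (a : 'rV[R]_n) (r : R) : 0 <= r ->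
  lebesgue_rV R n (box a r) = ((2 * r) ^+ n)%:E.
Proof.
move=> r0; elim: n a => [|n IH] a.
  by rewrite expr0 /= diracE mem_set// => -[].
transitivity ((@lebesgue_measure R \x lebesgue_rV R n)%E ((@cons_rV R n) @^-1` box a r)) => //.
have -> : (@cons_rV R n) @^-1` box a r =
    `[a ord0 ord0 - r, a ord0 ord0 + r]%classic `*` box (uncons_rV a).2 r.
  by apply/seteqP; split=> p /=; rewrite in_itv/= -ler_distl => /box_consE.
rewrite product_measure1E//; last exact: measurable_box.
rewrite IH exprS EFinM; congr (_ * _)%E.
have -> : 2 * r = (a ord0 ord0 + r) - (a ord0 ord0 - r) by ring.
rewrite EFinB; have := @lebesgue_measure_itv R `[a ord0 ord0 - r, a ord0 ord0 + r].
rewrite /= lte_fin; case: ifPn => // H E; apply: (etrans E).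
rewrite -EFinB; congr EFin; move: H; rewrite -leNgt; lra.
Qed.

Lemma lebesgue_box_lty n (a : 'rV[R]_n) (r : R) : (lebesgue_rV R n (box a r) < +oo)%E.
Proof.
have [r0|r0] := leP 0 r; first by rewrite lebesgue_box// ltry.
apply: (@le_lt_trans _ _ (lebesgue_rV R n (box a 0))).
  apply: le_measure; rewrite ?inE; [exact: measurable_box..|].
  by move=> x xr i; rewrite (le_trans (xr i))// ltW.
by rewrite lebesgue_box// ltry.
Qed.

End lebesgue_boxes.

Section continuous_compact_support.
Context {R : realType}.

Lemma integrable_box n (a : 'rV[R]_n) (r : R) (f : 'rV[R]_n -> R) :
  continuous f -> (forall x, ~ box a r x -> f x = 0) ->
  (lebesgue_rV R n).-integrable setT (EFin \o f).
Proof.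
move=> cf f0.
have -> : EFin \o f = (EFin \o f) \_ (box a r).
  apply/funext => x; rewrite patchE; case: ifPn => //.
  by rewrite notin_setE => /f0 /= ->.
apply/(integrable_mkcond _ (measurable_box a r)).
apply: measurable_bounded_integrable.
- exact: measurable_box.
- exact: lebesgue_box_lty.
- exact: measurable_funTS (continuous_measurable_rV cf).
have : compact (f @` box a r).
  by apply: continuous_compact; [exact: continuous_subspaceT|exact: compact_box].
move=> /compact_bounded [M [Mr HM]]; exists M; split=> // z Mz x bx.
by apply: HM => //; exists x.
Qed.

(** The measure in dimension n + 1 is the image of a product under [cons_rV]; integrability on the
    product is what Fubini requires. *)
Lemma integral_cons n (f : 'rV[R]_n.+1 -> R) :
  (lebesgue_rV R n.+1).-integrable setT (EFin \o f) ->
  (@lebesgue_measure R \x lebesgue_rV R n)%E.-integrable setT (EFin \o (f \o @cons_rV R n)) /\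
  (\int[lebesgue_rV R n.+1]_x (f x)%:E =
   \int[(@lebesgue_measure R \x lebesgue_rV R n)]_p (f (cons_rV p))%:E)%E.
Proof.
move=> /integrableP[mf lf].
have int : (@lebesgue_measure R \x lebesgue_rV R n)%E.-integrable setT (EFin \o (f \o @cons_rV R n)).
  apply/integrableP; split.
    apply/measurable_EFinP; apply: measurableT_comp; last exact: measurable_cons_rV.
    exact/measurable_EFinP.
  apply: le_lt_trans lf; rewrite le_eqVlt; apply/orP; left; apply/eqP.
  apply/esym.
  apply: (etrans (ge0_integral_pushforward (@measurable_cons_rV R n) _ _ _ _)) => //.
  exact: measurableT_comp mf.
split=> //.
by apply: (etrans (integral_pushforward (@measurable_cons_rV R n) mf _ _)).
Qed.

End continuous_compact_support.

(** * Integrals of partial derivatives with compact support *)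

Section divergence.
Context {R : realType}.

Lemma cons_rV_tail_continuous n (t : R) :
  continuous ((fun y => cons_rV (t, y)) : 'rV[R]_n -> 'rV[R]_n.+1).
Proof.
move=> y A /nbhs_ballP[e /= e0 eA]; apply: filterS (nbhsx_ballx y e e0) => z [_ yz].
apply: eA; split=> // i j; rewrite ord1; case: (unliftP ord0 j) => [k ->|->].
  by rewrite !cons_rV_tail; exact: yz.
by rewrite !cons_rV_head; exact: ballxx.
Qed.

Lemma cons_rV_head_continuous n (y : 'rV[R]_n) :
  continuous ((fun t => cons_rV (t, y)) : R -> 'rV[R]_n.+1).
Proof.
move=> t A /nbhs_ballP[e /= e0 eA]; apply: filterS (nbhsx_ballx t e e0) => z tz.
apply: eA; split=> // i j; rewrite ord1; case: (unliftP ord0 j) => [k ->|->].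
  by rewrite !cons_rV_tail; exact: ballxx.
by rewrite !cons_rV_head.
Qed.

Lemma cons_rV_line_tail n (t : R) (y : 'rV[R]_n) j (h : R) :
  h *: delta_mx ord0 (lift ord0 j) + cons_rV (t, y) =
  cons_rV (t, h *: delta_mx ord0 j + y).
Proof.
apply/rowP => k; rewrite mxE; case: (unliftP ord0 k) => [l ->|->].
  by rewrite !cons_rV_tail !mxE /= (inj_eq lift_inj).
by rewrite !cons_rV_head !mxE /= mulr0 add0r.
Qed.

Lemma cons_rV_line_head n (t : R) (y : 'rV[R]_n) (h : R) :
  h *: delta_mx ord0 ord0 + cons_rV (t, y) = cons_rV ((h + t : R), y).
Proof.
apply/rowP => k; rewrite mxE; case: (unliftP ord0 k) => [l ->|->].
  by rewrite !cons_rV_tail !mxE /= mulr0 add0r.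
by rewrite !cons_rV_head !mxE /= mulr1.
Qed.

Lemma integral_derive1_eq0 (g g1 : R -> R) (a r : R) : (forall t : R, is_derive t 1 g (g1 t)) ->
  continuous g1 -> (forall t, ~ `|t - a| <= r -> g t = 0) -> (forall t, ~ `|t - a| <= r -> g1 t = 0) ->
  (\int[lebesgue_measure]_t (g1 t)%:E = 0)%E.
Proof.
move=> dg cg1 g0 g10.
(* The margin 1 makes g vanish at both endpoints, and the absolute value keeps b < c when r is
   negative. *)
pose b := a - `|r| - 1; pose c := a + `|r| + 1.
have bc : b < c by rewrite /b /c; have := normr_ge0 r; lra.
have out t : ~ (b < t < c) -> ~ `|t - a| <= r.
  move=> H Ht; apply: H; move: Ht; rewrite ler_distl /b /c => /andP[? ?].
  by have := ler_norm r; apply: (fun H => _) => ?; apply/andP; split; lra.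
have cg : continuous g.
  by move=> t; apply/differentiable_continuous/derivable1_diffP; case: (dg t).
have -> : (fun t => (g1 t)%:E) = (EFin \o g1) \_ `[b, c].
  apply/funext => t; rewrite patchE /=; case: ifPn => //.
  rewrite notin_setE/= in_itv/= => H; rewrite g10//; apply: out.
  by move=> /andP[? ?]; apply: H; rewrite !ltW.
rewrite -integral_mkcond (@continuous_FTC2 _ g1 g b c bc).
- by rewrite !g0 ?sube0//; apply: out; rewrite ltxx ?andbF.
- exact: continuous_subspaceT.
- split; first by move=> t _; case: (dg t).
  + by apply: cvg_at_right_filter; exact: cg.
  + by apply: cvg_at_left_filter; exact: cg.
- by move=> t _; rewrite derive1E; case: (dg t).
Qed.

(** Fubini is applied in the order that integrates first over the factor containing the
    differentiated coordinate: the induction hypothesis handles the tail, the fundamental theorem of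
    calculus the head. *)
Lemma integral_partial_eq0 n (a : 'rV[R]_n) (r : R) (F G : 'rV[R]_n -> R) i :
  (forall x, is_derive x (delta_mx ord0 i) F (G x)) -> continuous G ->
  (forall x, ~ box a r x -> F x = 0) ->
  (\int[lebesgue_rV R n]_x (G x)%:E = 0)%E.
Proof.
elim: n a F G i => [|n IH] a F G i dF cG F0; first by case: i dF => -[].
have G0 x : ~ box a r x -> G x = 0.
  by move=> /(derive_notin_box (delta_mx ord0 i) F0); case: (dF x) => _ ->.
have [intG ->] := integral_cons (integrable_box cG G0).
case: (unliftP ord0 i) dF => [j ->|->] dF.
  rewrite -(integral12_prod_meas1 intG).
  rewrite integral0_eq// => t _.
  rewrite /fubini_F/=; apply: (IH (uncons_rV a).2 (fun y => F (cons_rV (t, y))) _ j).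
  - move=> y; apply/is_derive_lineP.
    have /is_derive_lineP := dF (cons_rV (t, y)).
    by under eq_fun do rewrite cons_rV_line_tail.
  - by move=> y; apply: continuous_comp; [exact: cons_rV_tail_continuous|exact: cG].
  - by move=> y yb; apply: F0 => /box_consE[].
rewrite -(integral21_prod_meas1 intG).
rewrite integral0_eq// => y _.
rewrite /fubini_G/=.
apply: (@integral_derive1_eq0 (fun t => F (cons_rV (t, y))) _ (a ord0 ord0) r).
- move=> t; apply/is_derive_lineP.
  have /is_derive_lineP := dF (cons_rV (t, y)).
  under eq_fun do rewrite cons_rV_line_head.
  by under [X in _ -> is_derive _ _ X _]eq_fun do rewrite [_ *: _]mulr1.
- by move=> t; apply: continuous_comp; [exact: cons_rV_head_continuous|exact: cG].
- by move=> t tb; apply: F0 => /box_consE[].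
- by move=> t tb; apply: G0 => /box_consE[].
Qed.

End divergence.

(** * From distributional to classical solutions *)

Section weak_to_strong.
Context {R : realType} {n : nat}.
Implicit Types (u g U G phi H : 'rV[R]_n -> R) (a x : 'rV[R]_n) (r : R).
Local Notation e_ i := (delta_mx ord0 i : 'rV[R]_n).
Local Notation mu := (lebesgue_rV R n).

Lemma continuous_fctM (f h : 'rV[R]_n -> R) :
  continuous f -> continuous h -> continuous (fun x => f x * h x).
Proof. by move=> cf ch x; exact: (cvgM (cf x) (ch x)). Qed.

Lemma continuous_fctB (f h : 'rV[R]_n -> R) :
  continuous f -> continuous h -> continuous (fun x => f x - h x).
Proof. by move=> cf ch x; exact: (cvgB (cf x) (ch x)). Qed.

Lemma laplacian_notin_box phi a r : (forall x, ~ box a r x -> phi x = 0) ->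
  forall x, ~ box a r x -> laplacian phi x = 0.
Proof.
move=> phi0 x xb; rewrite /laplacian big1// => i _.
exact: (derive_notin_box (e_ i) (derive_notin_box (e_ i) phi0)).
Qed.

(** Coordinate by coordinate, the integrand is the derivative of U_i phi - U phi_i, whose support is
    compact because that of phi is. *)
Lemma Rintegral_green U phi a r : is_Ck 2 U -> is_Ck 2 phi ->
  (forall x, ~ box a r x -> phi x = 0) ->
  \int[mu]_x (laplacian U x * phi x - U x * laplacian phi x) = 0.
Proof.
move=> U2 phi2 phi0.
pose G i x := 'D_(e_ i) ('D_(e_ i) U) x * phi x - U x * 'D_(e_ i) ('D_(e_ i) phi) x.
have cG i : continuous (G i).
  apply: continuous_fctB; apply: continuous_fctM.
  - exact: is_Ck_continuous (is_Ck_derive i (is_Ck_derive i U2)).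
  - exact: is_Ck_continuous phi2.
  - exact: is_Ck_continuous U2.
  - exact: is_Ck_continuous (is_Ck_derive i (is_Ck_derive i phi2)).
have Dphi0 i x : ~ box a r x -> 'D_(e_ i) phi x = 0 := derive_notin_box (e_ i) phi0 (x := x).
have DDphi0 i x : ~ box a r x -> 'D_(e_ i) ('D_(e_ i) phi) x = 0.
  exact: (derive_notin_box (e_ i) (Dphi0 i)).
have G0 i x : ~ box a r x -> G i x = 0.
  by move=> xb; rewrite /G phi0// DDphi0// !mulr0 subr0.
have intG i : (\int[mu]_x (G i x)%:E = 0)%E.
  apply: (integral_partial_eq0 (a := a) (r := r) (i := i)
    (F := fun x => 'D_(e_ i) U x * phi x - U x * 'D_(e_ i) phi x)).
  - move=> x.
    have [dU dphi] := (is_Ck_is_derive x i U2, is_Ck_is_derive x i phi2).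
    have ddU := is_Ck_is_derive x i (is_Ck_derive i U2).
    have ddphi := is_Ck_is_derive x i (is_Ck_derive i phi2).
    apply: is_derive_eq (is_deriveB (is_deriveM ddU dphi) (is_deriveM dU ddphi)) _.
    rewrite /G /GRing.scale/=.
    move: ('D_ _ _ x) ('D_ _ _ x) ('D_ _ _ x) ('D_ _ _ x) => b c d e; ring.
  - exact: cG.
  - by move=> x xb; rewrite phi0// Dphi0// !mulr0 subr0.
rewrite /Rintegral.
have -> : (fun x => (laplacian U x * phi x - U x * laplacian phi x)%:E) =
    (fun x => \sum_(i < n) (G i x)%:E)%E.
  apply/funext => x; rewrite sumEFin; congr EFin.
  by rewrite /laplacian mulr_suml mulr_sumr -sumrB.
rewrite integral_sum//; last by move=> i; exact: integrable_box (cG i) (@G0 i).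
by rewrite big1.
Qed.

(** By continuity H exceeds H a / 2 on a small cube, whose volume (2 d)^n is positive. *)
Lemma Rintegral_gt0 H a r : continuous H -> (forall x, 0 <= H x) ->
  (forall x, ~ box a r x -> H x = 0) -> 0 < H a -> 0 < \int[mu]_x H x.
Proof.
move=> cH H0 Hb Ha.
have Ha2 : H a / 2 < H a by rewrite ltr_pdivrMr// mulr_natr mulr2n ltrDl.
have /nbhs_box[d d0 dH] : \forall x \near a, H a / 2 < H x := cH a _ (lt_nbhsr Ha2).
have intH := integrable_box cH Hb.
have mH : measurable_fun setT (EFin \o H) by case/integrableP: intH.
have : ((H a / 2 * (2 * d) ^+ n)%:E <= \int[mu]_x (H x)%:E)%E.
  rewrite EFinM -(lebesgue_box a (ltW d0)) -integral_cst; last exact: measurable_box.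
  apply: (@le_trans _ _ (\int[mu]_(x in box a d) (H x)%:E)%E).
    apply: ge0_le_integral => //.
    - exact: measurable_box.
    - by move=> x _; rewrite lee_fin divr_ge0// ltW.
    - exact: measurable_funTS.
    - by move=> x /dH /ltW; rewrite lee_fin.
  apply: ge0_subset_integral => //; first exact: measurable_box.
  by move=> x _; rewrite lee_fin.
rewrite /Rintegral; have := integrable_fin_num measurableT intH.
move=> /fineK {1}<-; rewrite lee_fin; apply: lt_le_trans.
by rewrite mulr_gt0 ?divr_gt0// exprn_gt0// mulr_gt0.
Qed.

(** Where H is positive, a bump supported in a cube on which H > 0 gives a positive integral;
    applying this to - H as well leaves only 0. *)
Lemma fundamental_lemma H : continuous H ->
  (forall phi a r, (forall k, is_Ck k phi) -> (forall x, ~ box a r x -> phi x = 0) ->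
     \int[mu]_x (H x * phi x) = 0) ->
  forall x, H x = 0.
Proof.
have main H' : continuous H' ->
    (forall phi a r, (forall k, is_Ck k phi) -> (forall x, ~ box a r x -> phi x = 0) ->
     \int[mu]_x (H' x * phi x) = 0) -> forall x, H' x <= 0.
  move=> cH HI a; rewrite leNgt; apply/negP => Ha.
  have /nbhs_box[r r0 rH] : \forall x \near a, 0 < H' x := cH a _ (lt_nbhsr Ha).
  have [phi [phik phi0 phia phib]] := bump_function a r0.
  have := HI phi a r phik phib; apply/eqP; rewrite gt_eqF//.
  apply: (@Rintegral_gt0 _ a r).
  - by apply: continuous_fctM => //; exact: is_Ck_continuous (phik 0).
  - move=> x; have [/rH/= /ltW Hx|/phib ->] := pselect (box a r x); last by rewrite mulr0.
    by rewrite mulr_ge0.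
  - by move=> x /phib ->; rewrite mulr0.
  - by rewrite mulr_gt0.
move=> cH HI x; apply/eqP; rewrite eq_le main//= -oppr_le0.
apply: (main (fun x => - H x)); first by move=> y; exact: (cvgN (cH y)).
move=> phi a r phik phi0.
rewrite -[RHS](HI (fun x => -1 * phi x) a r).
- by apply: eq_Rintegral => y _; ring.
- by move=> k; apply: is_CkM => //; exact: is_Ck_cst.
- by move=> y /phi0 ->; rewrite mulr0.
Qed.

(** Local integrability provides measurability of truncations to compact sets only; since psi
    vanishes off the cube, w may be truncated inside the product. *)
Lemma ae_eq_Rintegral_box (w W psi : 'rV[R]_n -> R) a r :
  measurable_fun setT (w \_ (box a r)) -> {ae mu, forall x, w x = W x} ->
  continuous W -> continuous psi -> (forall x, ~ box a r x -> psi x = 0) ->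
  \int[mu]_x (w x * psi x) = \int[mu]_x (W x * psi x).
Proof.
move=> mw aew cW cpsi psi0; rewrite /Rintegral; congr fine.
apply: ae_eq_integral => //.
- apply/measurable_EFinP.
  have -> : (fun x => w x * psi x) = (w \_ (box a r)) \* psi.
    apply/funext => x; rewrite /= patchE; case: ifPn => //.
    by rewrite notin_setE => /psi0 ->; rewrite !mulr0.
  by apply: measurable_funM => //; exact: continuous_measurable_rV.
- apply/measurable_EFinP; exact: continuous_measurable_rV (continuous_fctM cW cpsi).
- by apply: filterS aew => x wW _; rewrite wW.
Qed.

Lemma laplacian_of_distr u g U G : smooth U -> continuous G ->
  (forall a r, measurable_fun setT (u \_ (box a r))) -> {ae mu, forall x, u x = U x} ->
  (forall a r, measurable_fun setT (g \_ (box a r))) -> {ae mu, forall x, g x = G x} ->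
  neg_laplacian_distr u g -> forall x, laplacian U x = - G x.
Proof.
move=> Us cG mu_ aeu mg aeg ug x; apply/eqP; rewrite -addr_eq0; apply/eqP; move: x.
have cLU := laplacian_continuous (Us 2).
apply: fundamental_lemma.
  by move=> x; exact: (cvgD (cLU x) (cG x)).
move=> phi a r phik phi0.
have cphi := is_Ck_continuous (phik 0); have cLphi := laplacian_continuous (phik 2).
have cU := is_Ck_continuous (Us 2).
have Lphi0 := laplacian_notin_box phi0.
have cNL : continuous (fun x => - laplacian phi x) by move=> x; exact: (cvgN (cLphi x)).
have NL0 x : ~ box a r x -> - laplacian phi x = 0 by move=> /Lphi0 ->; rewrite oppr0.
have := ug phi (test_function_box phik phi0).
rewrite (ae_eq_Rintegral_box (mu_ a r) aeu cU cNL NL0).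
rewrite (ae_eq_Rintegral_box (mg a r) aeg cG cphi phi0) => E.
have I1 : mu.-integrable setT (EFin \o (fun x => laplacian U x * phi x - U x * laplacian phi x)).
  apply: (integrable_box (a := a) (r := r)).
    by apply: continuous_fctB; exact: continuous_fctM.
  by move=> x xb; rewrite phi0// Lphi0// !mulr0 subr0.
have I2 : mu.-integrable setT (EFin \o (fun x => U x * - laplacian phi x)).
  apply: (integrable_box (a := a) (r := r)); first exact: continuous_fctM.
  by move=> x xb; rewrite NL0// mulr0.
have I3 : mu.-integrable setT (EFin \o (fun x => G x * phi x)).
  apply: (integrable_box (a := a) (r := r)); first exact: continuous_fctM.
  by move=> x xb; rewrite phi0// mulr0.
(* The first bracket integrates to 0 by Green's identity, the second by the distributional
   equation. *)
transitivity (\int[mu]_x ((laplacian U x * phi x - U x * laplacian phi x) +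
    (G x * phi x - U x * - laplacian phi x))).
  apply: eq_Rintegral => x _.
  by move: (laplacian U x) (laplacian phi x) => b c; ring.
have I4 : mu.-integrable setT (EFin \o (fun x => G x * phi x - U x * - laplacian phi x)).
  apply: (integrable_box (a := a) (r := r)).
    by apply: continuous_fctB; exact: continuous_fctM.
  by move=> x xb; rewrite phi0// NL0// !mulr0 subr0.
rewrite (RintegralD measurableT I1 I4).
by rewrite (RintegralB measurableT I3 I2) E subrr addr0 (Rintegral_green (Us 2) (phik 2) phi0).
Qed.

End weak_to_strong.

(** * The system for the smooth representatives *)

Section solutions.
Context {R : realType} {n : nat}.
Implicit Types (u v U V : 'rV[R]_n -> R).
Local Notation e_ i := (delta_mx ord0 i : 'rV[R]_n).

Lemma locally_Lp_measurable (p : \bar R) u a r :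
  locally_Lp p u -> measurable_fun setT (u \_ (box a r)).
Proof.
by move=> /(_ _ (@compact_box _ _ a r)) /sub_Lfun_mfun; rewrite inE.
Qed.

(** Truncation by 0 commutes with products and differences, so measurability of the truncated u and
    v passes to the truncated nonlinearity. *)
Lemma patchM (A : set 'rV[R]_n) u v : (u \_ A) \* (v \_ A) = (fun x => u x * v x) \_ A.
Proof.
by apply/funext => x; rewrite /= !patchE; case: ifP => // _; rewrite mulr0.
Qed.

Lemma patchB (A : set 'rV[R]_n) u v : (u \_ A) \- (v \_ A) = (fun x => u x - v x) \_ A.
Proof.
by apply/funext => x; rewrite /= !patchE; case: ifP => // _; rewrite subr0.
Qed.

Lemma laplacian_of_solution u v U V :
  locally_Lp 3%:E u -> locally_Lp 3%:E v ->
  smooth_representative u U -> smooth_representative v V ->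
  neg_laplacian_distr u (fun x => u x - u x ^+ 3 - u x * v x ^+ 2) ->
  forall x, laplacian U x = - (U x * (1 - (U x * U x + V x * V x))).
Proof.
move=> Lu Lv [Us uU] [Vs vV] Hu x.
pose g (u v : 'rV[R]_n -> R) x := u x - u x * (u x * u x) - u x * (v x * v x).
have gE x' : g U V x' = U x' * (1 - (U x' * U x' + V x' * V x')) by rewrite /g; ring.
rewrite -gE; move: x; apply: (laplacian_of_distr (u := u) (g := g u v)) => //.
- have [cU cV] := (is_Ck_continuous (Us 0), is_Ck_continuous (Vs 0)).
  by do 2 (apply: continuous_fctB; last by do 2! (apply: continuous_fctM => //)).
- by move=> a r; exact: locally_Lp_measurable Lu.
- move=> a r; have [mu_ mv] := (locally_Lp_measurable a r Lu, locally_Lp_measurable a r Lv).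
  rewrite /g -patchB -patchB -!patchM.
  by do 2! (apply: measurable_funB; last by do 2! (apply: measurable_funM => //)).
- by apply: filterS2 uU vV => y uUy vVy; rewrite /g uUy vVy.
Qed.

Lemma laplacian_sqr_ge U x : is_Ck 2 U ->
  2 * (U x * laplacian U x) <= laplacian (fun x => U x * U x) x.
Proof.
move=> U2; rewrite (laplacianM x U2 U2).
have : 0 <= \sum_(i < n) 'D_(e_ i) U x * 'D_(e_ i) U x.
  by apply: sumr_ge0 => i _; rewrite -expr2 sqr_ge0.
lra.
Qed.

(** With S = U^2 + V^2 = 1 - c, dropping the squared gradients leaves Delta S >= - 2 c S. Hence
    Delta c <= 2 c - 2 c^2, and where c < 0 the linear term has the favourable sign. *)
Lemma system_sqr_le1 U V : is_Ck 2 U -> is_Ck 2 V ->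
  (forall x, laplacian U x = - (U x * (1 - (U x * U x + V x * V x)))) ->
  (forall x, laplacian V x = - (V x * (1 - (U x * U x + V x * V x)))) ->
  forall x, 0 <= 1 - (U x * U x + V x * V x).
Proof.
move=> U2 V2 LU LV x.
pose S x := U x * U x + V x * V x.
have [UU2 VV2] := (is_CkM U2 U2, is_CkM V2 V2).
have S2 : is_Ck 2 S := is_CkD UU2 VV2.
have NS2 := is_CkM (is_Ck_cst 2 (-1)) S2.
have -> : 1 - (U x * U x + V x * V x) = 1 + -1 * S x by rewrite mulN1r.
apply: (ge0_of_laplacian_le (is_CkD (is_Ck_cst 2 1) NS2)) => {}x cx.
rewrite (laplacianD x (is_Ck_cst 2 1) NS2) laplacian_cst add0r (laplacianZ _ _ S2).
rewrite (laplacianD x UU2 VV2).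
have := laplacian_sqr_ge x U2; have := laplacian_sqr_ge x V2.
rewrite LU LV => HV HU.
set c := 1 + -1 * S x in cx *.
have cE : 1 - (U x * U x + V x * V x) = c by rewrite /c mulN1r.
rewrite cE in HU HV.
have SE : U x * U x + V x * V x = 1 - c by rewrite -cE; ring.
have : 2 * (U x * - (U x * c)) + 2 * (V x * - (V x * c)) = - (2 * c) * (U x * U x + V x * V x).
  by ring.
rewrite SE; move: HU HV.
move: (laplacian _ _) (laplacian _ _) (2 * (U x * _)) (2 * (V x * _)) => lu lv a b HU HV E.
nra.
Qed.

End solutions.

Theorem theorem1p7 (R : realType) (N : nat) (hN : (1 <= N <= 2)%N)
    (u v : 'rV[R]_N -> R) (huv : is_solution u v)
    (hu : everywhere_positive u) (hv : everywhere_positive v) :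
  exists a b : R,
    [/\ {ae lebesgue_rV R N, forall x, u x = a},
        {ae lebesgue_rV R N, forall x, v x = b} &
        a ^+ 2 + b ^+ 2 = 1].
Proof.
have [Lu Lv Hu Hv] := huv; have [U rU U0] := hu; have [V rV V0] := hv.
have LU := laplacian_of_solution Lu Lv rU rV Hu.
have LV x : laplacian V x = - (V x * (1 - (U x * U x + V x * V x))).
  (* The system is symmetric under exchanging u and v, up to the order of the factors in u^2 v. *)
  rewrite [U x * U x + _]addrC; apply: (laplacian_of_solution Lv Lu rV rU) => phi phit.
  by rewrite (Hv phi phit); apply: eq_Rintegral => y _; ring.
have [[Us uU] [Vs vV]] := (rU, rV).
have c0 := system_sqr_le1 (Us 2) (Vs 2) LU LV.
have N2 : (N <= 2)%N by case/andP: hN.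
have Ucst : forall x, U x = U 0.
  move=> x; apply: (superharmonic_cst N2 (Us 2)) => y; first exact: ltW.
  by rewrite LU oppr_le0 mulr_ge0// ltW.
have Vcst : forall x, V x = V 0.
  move=> x; apply: (superharmonic_cst N2 (Vs 2)) => y; first exact: ltW.
  by rewrite LV oppr_le0 mulr_ge0// ltW.
exists (U 0), (V 0); split.
- by apply: filterS uU => x ->.
- by apply: filterS vV => x ->.
have := LU 0.
have -> : U = (fun=> U 0) by apply/funext.
rewrite laplacian_cst => /esym/eqP; rewrite oppr_eq0 mulf_eq0 gt_eqF//=.
by rewrite subr_eq0 !expr2 => /eqP.
Qed.
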